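(* Let $G$ be a commutative Krasner $(m,n)$-hyperring with scalar identity $1$, let $\delta$ be a hyperideal expansion of $G$, and let $t$ be a positive integer. Let $Q$ be a weakly $(t,n)$-absorbing $\delta$-semiprimary hyperideal of $G$ which is not a $(t,n)$-absorbing $\delta$-semiprimary hyperideal of $G$. Then $k(Q^{(tn-t+1)})=0$, i.e. $k(q_1,\dots,q_{tn-t+1})=0$ for all $q_1,\dots,q_{tn-t+1}\in Q$.
   Context: Notation: $a_i^j$ is the sequence $a_i,a_{i+1},\dots,a_j$ (empty if $j<i$), $a^{(r)}$ is $a$ repeated $r$ times; $m,n\ge 2$ are integers. A Krasner $(m,n)$-hyperring $(G,h,k)$ consists of a set $G$, an $m$-ary hyperoperation $h$ (with values nonempty subsets of $G$, extended to subsets by unions) and an $n$-ary operation $k:G^n\to G$ such that: (1) $(G,h)$ is a canonical $m$-ary hypergroup, i.e. $h$ is associative and invariant under permutation of its arguments, there is a unique element $0$ with $h(x,0^{(m-1)})=\{x\}$ for all $x$, each $x$ has a unique $-x$ with $0\in h(x,-x,0^{(m-2)})$, and $x\in h(x_1^m)$ implies $x_i\in h(x,-x_1,\dots,-x_{i-1},-x_{i+1},\dots,-x_m)$ for each $i$; (2) $k$ is associative ($(G,k)$ is an $n$-ary semigroup); (3) $k(g_1^{i-1},h(x_1^m),g_{i+1}^n)=h(k(g_1^{i-1},x_1,g_{i+1}^n),\dots,k(g_1^{i-1},x_m,g_{i+1}^n))$ for each $i$; (4) $k$ equals $0$ whenever one of its arguments is $0$. It is commutative if $k$ is invariant under permutation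 of its arguments; $1$ is a scalar identity if $k(x,1^{(n-1)})=x$ for all $x$. By iterating, $k$ is defined on any $l(n-1)+1$ elements, $l\ge 0$ (for $l=0$ the product of one element is that element); note $tn-t+1=t(n-1)+1$ and $(t-1)n-t+2=(t-1)(n-1)+1$. When arguments of $k$ are subsets, $k$ denotes the set of all corresponding products of elements. A hyperideal is a nonempty $I\subseteq G$ such that $(I,h)$ is an $m$-ary subhypergroup of $(G,h)$ (so $I$ is closed under $h$ and negatives) and $k(g_1^{i-1},I,g_{i+1}^n)\subseteq I$ for all $g_j\in G$ and all $i$. A hyperideal expansion of $G$ is a function $\delta$ from hyperideals to hyperideals of $G$ with $I\subseteq\delta(I)$, and $I\subseteq J$ implying $\delta(I)\subseteq\delta(J)$. A proper hyperideal $Q$ of $G$ is $(t,n)$-absorbing $\delta$-semiprimary if whenever $k(a_1^{tn-t+1})\in Q$ for $a_1,\dots,a_{tn-t+1}\in G$, there exist $(t-1)n-t+2$ of the $a_i$'s (distinct indices) whose $k$-product is in $\delta(Q)$. It is weakly $(t,n)$-absorbing $\delta$-semiprimary if the same conclusion holds whenever $0\ne k(a_1^{tn-t+1})\in Q$. *)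

(* Defs.v *)
From mathcomp Require Import all_boot all_fingroup.
From mathcomp Require Import all_classical.

Set Implicit Arguments.
Unset Strict Implicit.
Unset Printing Implicit Defensive.

Local Open Scope classical_set_scope.

(* Arguments of an n-ary operation are families indexed by 'I_n, numbered     *)
(* from 0: the argument written x_(i+1) in the usual notation is x i.         *)

(* The n arguments consisting of s followed by repetitions of e. *)
Definition pad (T : Type) (n : nat) (s : seq T) (e : T) : 'I_n -> T :=
  fun p => nth e s p.

(* For x = (x_1, ..., x_(2n-1)), window x i is (x_(i+1), ..., x_(i+n)) and    *)
(* splice x i y is (x_1, ..., x_i, y, x_(i+n+1), ..., x_(2n-1)).              *)
(* All uses of inord below are within bounds.                                 *)
Definition window (T : Type) (n : nat) (x : 'I_(2 * n.-1).+1 -> T) (i : 'I_n) :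
    'I_n -> T :=
  fun q => x (inord (i + q)).

Definition splice (T : Type) (n : nat) (x : 'I_(2 * n.-1).+1 -> T) (i : 'I_n)
    (y : T) : 'I_n -> T :=
  fun p => if p < i then x (inord p)
           else if p == i then y
           else x (inord (p + n.-1)).

Definition hext (G : Type) (m : nat) (h : ('I_m -> G) -> set G)
    (X : 'I_m -> set G) : set G :=
  [set y | exists x : 'I_m -> G, (forall i, X i (x i)) /\ h x y].

(* The zero and the negatives are unique, so taking them as parameters adds   *)
(* no structure. In ch_reversible the arguments are                           *)
(* y, -x_1, ..., -x_(i-1), -x_(i+1), ..., -x_m; ord_pred is the predecessor.  *)
Record canonical_hypergroup (G : Type) (m : nat) (h : ('I_m -> G) -> set G)
    (zero : G) (opp : G -> G) : Prop := CanonicalHypergroup {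
  ch_nonempty : forall x : 'I_m -> G, h x !=set0;
  ch_assoc : forall (x : 'I_(2 * m.-1).+1 -> G) (i j : 'I_m),
    hext h (splice (fun p => [set x p]) i (h (window x i))) =
    hext h (splice (fun p => [set x p]) j (h (window x j)));
  ch_comm : forall (x : 'I_m -> G) (s : 'S_m), h (x \o s) = h x;
  ch_zero : forall x : G, h (pad [:: x] zero) = [set x];
  ch_zero_unique : forall e : G,
    (forall x : G, h (pad [:: x] e) = [set x]) -> e = zero;
  ch_opp : forall x : G, h (pad [:: x; opp x] zero) zero;
  ch_opp_unique : forall x y : G, h (pad [:: x; y] zero) zero -> y = opp x;
  ch_reversible : forall (x : 'I_m -> G) (y : G) (i : 'I_m), h x y ->
    h (fun p => if p == 0 :> nat then y
                else opp (x (if p <= i then ord_pred p else p))) (x i)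
}.

Record krasner_hyperring (m n : nat) := KrasnerHyperring {
  carrier :> Type;
  hadd : ('I_m -> carrier) -> set carrier;
  kmul : ('I_n -> carrier) -> carrier;
  hzero : carrier;
  hopp : carrier -> carrier;
  hadd_canonical : canonical_hypergroup hadd hzero hopp;
  kmul_assoc : forall (x : 'I_(2 * n.-1).+1 -> carrier) (i j : 'I_n),
    kmul (splice x i (kmul (window x i))) =
    kmul (splice x j (kmul (window x j)));
  kmul_distr : forall (g : 'I_n -> carrier) (i : 'I_n) (x : 'I_m -> carrier),
    [set kmul [eta g with i |-> y] | y in hadd x] =
    hadd (fun j => kmul [eta g with i |-> x j]);
  kmul_zero : forall (g : 'I_n -> carrier) (i : 'I_n),
    g i = hzero -> kmul g = hzero
}.

Arguments hzero {m n} _.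

Section KrasnerHyperring.
Variables (m n : nat) (G : krasner_hyperring m n).

Definition commutative_hyperring : Prop :=
  forall (x : 'I_n -> G) (s : 'S_n), kmul (x \o s) = kmul x.

Definition scalar_identity (one : G) : Prop :=
  forall x : G, kmul (pad [:: x] one) = x.

(* The kmul-product of l(n-1)+1 elements, bracketed to the left. *)
Fixpoint kprod (l : nat) : ('I_(l * n.-1).+1 -> G) -> G :=
  match l with
  | 0 => fun x => x ord0
  | l'.+1 => fun x =>
      kmul (fun p : 'I_n =>
        if p == 0 :> nat then kprod (l := l') (fun i => x (inord i))
        else x (inord (l' * n.-1 + p)))
  end.

(* Membership of 0 is not required here: for a hyperideal it follows from     *)
(* nonemptiness and absorption.                                               *)
Definition subhypergroup (I : set G) : Prop :=
  [/\ I !=set0,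
      forall x : 'I_m -> G, (forall i, I (x i)) -> hadd x `<=` I
    & forall x : G, I x -> I (hopp x)].

Record hyperideal := Hyperideal {
  ideal_set :> set G;
  ideal_subhypergroup : subhypergroup ideal_set;
  ideal_absorb : forall (g : 'I_n -> G) (i : 'I_n),
    ideal_set (g i) -> ideal_set (kmul g)
}.

Definition hyperideal_expansion (delta : hyperideal -> hyperideal) : Prop :=
  (forall I : hyperideal, I `<=` delta I) /\
  (forall I J : hyperideal, I `<=` J -> delta I `<=` delta J).

Definition proper_hyperideal (I : hyperideal) : Prop := ideal_set I <> setT.

(* Some (t-1)(n-1)+1 of the t(n-1)+1 elements a_i have their product in S.    *)
Definition has_subproduct_in (t : nat) (S : set G)
    (a : 'I_(t * n.-1).+1 -> G) : Prop :=
  exists f : 'I_(t.-1 * n.-1).+1 -> 'I_(t * n.-1).+1,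
    injective f /\ S (kprod (a \o f)).

Definition absorbing_semiprimary (t : nat) (delta : hyperideal -> hyperideal)
    (Q : hyperideal) : Prop :=
  proper_hyperideal Q /\
  forall a : 'I_(t * n.-1).+1 -> G,
    ideal_set Q (kprod a) -> has_subproduct_in (delta Q) a.

Definition weakly_absorbing_semiprimary (t : nat)
    (delta : hyperideal -> hyperideal) (Q : hyperideal) : Prop :=
  proper_hyperideal Q /\
  forall a : 'I_(t * n.-1).+1 -> G,
    kprod a <> hzero G -> ideal_set Q (kprod a) -> has_subproduct_in (delta Q) a.

End KrasnerHyperring.

(* Main.v *)
Require Import Defs.
From mathcomp Require Import all_boot all_fingroup.
From mathcomp Require Import all_classical.

(** Write [N = t(n-1)+1], and call an [N]-tuple [a] an _obstruction_ when its
    product lies in [Q] while no product of [(t-1)(n-1)+1] of its entries lies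
    in [delta Q].  An obstruction exists because [Q] is not absorbing, and
    every obstruction has product [0] because [Q] is weakly absorbing.

    The key point ([obstruction_perturb]) is that obstructions are stable under
    perturbation by [Q]: if [b] belongs to [q + a_i] with [q] in [Q], then
    replacing [a_i] by [b] gives an obstruction again.  Indeed, products
    distribute over the hyperaddition in each slot, so the new product is in
    [Q + Q]; and since [a_i] belongs to [-q + b] by reversibility, a subproduct
    of the new tuple lying in [delta Q] would force the corresponding
    subproduct of [a] into [Q + delta Q], which is contained in [delta Q].

    One then replaces the entries of an obstruction by elements of [Q] one at a
    time, showing that for every obstruction [a] and every [r] the product
    [k(q_1, ..., q_r, a_(r+1), ..., a_N)] vanishes ([kprod_mix_eq0]).  For the
    step from [r] to [r+1], let [F] be this product as a function of the entry
    in position [r+1].  By the induction hypothesis [F] is [0] at [a_(r+1)]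
    and, by stability, at every element of [q_(r+1) + a_(r+1)]; hence
    [{0} = F(q_(r+1) + a_(r+1)) = F(q_(r+1)) + 0 = {F(q_(r+1))}]. *)

Set Implicit Arguments.
Unset Strict Implicit.
Unset Printing Implicit Defensive.

Local Open Scope classical_set_scope.

Section Obstructions.
Variables (m n : nat) (hm : 2 <= m) (hn : 2 <= n) (G : krasner_hyperring m n).

(** * Sums of two elements *)

(** The binary hyperaddition [u + v], that is [h(u, v, 0, ..., 0)]. *)
Definition hadd2 (u v : G) : set G := hadd (pad [:: u; v] (hzero G)).

Lemma hadd2_zeror (u : G) : hadd2 u (hzero G) = [set u].
Proof.
rewrite -(ch_zero (hadd_canonical G)) /hadd2; congr hadd.
by apply/funext => -[[|[|p]] hp] //; rewrite /pad /= nth_nil.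
Qed.

Lemma hopp_zero : hopp (hzero G) = hzero G.
Proof.
apply/esym/(ch_opp_unique (hadd_canonical G)).
by have := hadd2_zeror (hzero G); rewrite /hadd2 => ->.
Qed.

Lemma hadd2_reversible (u v b : G) : hadd2 u v b -> hadd2 (hopp u) b v.
Proof.
(* Reversibility in the slot of [v] puts [v] in [b + (- u)], and swapping the
   first two arguments of [h] puts it in [- u + b]. *)
move=> uvb.
have m1 : 1 < m := hm; have m0 : 0 < m := ltnW hm.
have := ch_reversible (hadd_canonical G) (Ordinal m1) uvb.
rewrite -(ch_comm (hadd_canonical G) _ (tperm (Ordinal m0) (Ordinal m1))) /=.
rewrite /hadd2; congr (hadd _ _); apply/funext => p /=.
case: tpermP => [->|->|/eqP p0 /eqP p1] /=.
- by rewrite /pad /= modnn.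
- by [].
- move: p0 p1; case: p => -[|[|p]] hp //= _ _.
  by rewrite /pad /= nth_nil hopp_zero.
Qed.

(** * Hyperideals *)

Lemma hyperideal_zero (I : hyperideal G) : ideal_set I (hzero G).
Proof.
have [[x Ix] _ _] := ideal_subhypergroup I.
have n0 : 0 < n := ltnW hn.
rewrite -(@kmul_zero _ _ _ (pad [:: x; hzero G] (hzero G)) (Ordinal hn)) //.
exact: (@ideal_absorb _ _ _ I _ (Ordinal n0)).
Qed.

Lemma hyperideal_hadd2 (I : hyperideal G) (u v : G) :
  ideal_set I u -> ideal_set I v -> hadd2 u v `<=` ideal_set I.
Proof.
have [_ Ihadd _] := ideal_subhypergroup I.
move=> Iu Iv; apply: Ihadd => -[[|[|p]] hp] //.
by rewrite /pad /= nth_nil; exact: hyperideal_zero.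
Qed.

Lemma hyperideal_hopp (I : hyperideal G) (u : G) :
  ideal_set I u -> ideal_set I (hopp u).
Proof. by have [_ _ Iopp] := ideal_subhypergroup I; exact: Iopp. Qed.

(** * Iterated products as functions of one argument *)

(** The maps obtained from the identity by repeatedly fixing all the arguments
    of [k] but one.  They capture what an iterated product becomes when all of
    its factors but one are fixed, independently of the bracketing. *)
Inductive translation : (G -> G) -> Prop :=
| translation_id : translation id
| translation_kmul (g : 'I_n -> G) (p : 'I_n) (F : G -> G) :
    translation F -> translation (fun y => kmul [eta g with p |-> F y]).

Lemma translation_zero (F : G -> G) : translation F -> F (hzero G) = hzero G.
Proof.
by elim=> // g p {}F _ F0; apply: (@kmul_zero _ _ _ _ p); rewrite /= eqxx F0.
Qed.

Lemma translation_absorb (I : hyperideal G) (F : G -> G) (y : G) :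
  translation F -> ideal_set I y -> ideal_set I (F y).
Proof.
move=> tF Iy; elim: tF => // g p {}F _ IF.
by apply: (@ideal_absorb _ _ _ I _ p); rewrite /= eqxx.
Qed.

Lemma translation_hadd (F : G -> G) (z : 'I_m -> G) :
  translation F -> F @` hadd z = hadd (F \o z).
Proof.
elim=> [|g p {}F _ IF]; first by rewrite image_id.
by rewrite -(kmul_distr g p (F \o z)) -IF image_comp.
Qed.

Lemma translation_hadd2 (F : G -> G) (u v : G) :
  translation F -> F @` hadd2 u v = hadd2 (F u) (F v).
Proof.
move=> tF; rewrite /hadd2 translation_hadd //; congr hadd.
apply/funext => -[[|[|p]] hp] //.
by rewrite /pad /= !nth_nil translation_zero.
Qed.

Lemma kprod_translation (l : nat) (x : 'I_(l * n.-1).+1 -> G)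
    (i : 'I_(l * n.-1).+1) :
  translation (fun y => kprod [eta x with i |-> y]).
Proof.
have n0 : 0 < n := ltnW hn.
elim: l x i => [|l IH] x i.
  rewrite (_ : (fun y => _) = id); first exact: translation_id.
  by apply/funext => y /=; rewrite (ord1 i).
pose g (p : 'I_n) := if p == 0 :> nat
  then kprod (l := l) (fun j => x (inord j)) else x (inord (l * n.-1 + p)).
have le_l (j : 'I_(l * n.-1).+1) : j < (l.+1 * n.-1).+1.
  by rewrite (leq_trans (ltn_ord j)) // ltnS leq_mul2r leqnSn orbT.
have le_p (p : 'I_n) : l * n.-1 + p < (l.+1 * n.-1).+1.
  by rewrite ltnS mulSn addnC leq_add2r -ltnS prednK.
have [il|li] := leqP i (l * n.-1).
- (* The slot is inside the inner product, the argument 0 of the last [k]. *)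
  have := translation_kmul g (Ordinal n0)
    (IH (fun j => x (inord j)) (Ordinal (il : i < (l * n.-1).+1))).
  congr translation; apply/funext => y /=; congr kmul; apply/funext => p /=.
  rewrite -(inj_eq val_inj) /g /=; case: eqP => p0.
    congr kprod; apply/funext => j /=.
    by rewrite -!(inj_eq val_inj) /= inordK.
  case: eqP => // /(congr1 val); rewrite /= inordK // => pi.
  by move: il; rewrite -pi -{2}[l * _]addn0 leq_add2l leqn0 => /eqP.
- (* The slot is one of the other arguments of the last [k]. *)
  have ip : i - l * n.-1 < n.
    rewrite ltn_subLR ?(ltnW li) //.
    have lt_i : i < (n.-1 + l * n.-1).+1 := ltn_ord i.
    by rewrite (leq_trans lt_i) // -addSn prednK // addnC.
  have := translation_kmul g (Ordinal ip) translation_id.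
  congr translation; apply/funext => y /=; congr kmul; apply/funext => p /=.
  rewrite -!(inj_eq val_inj) /= /g; case: (eqVneq (val p) 0) => [p0|p0].
    rewrite p0 eq_sym subn_eq0 leqNgt li /=.
    congr kprod; apply/funext => j /=.
    rewrite -(inj_eq val_inj) /= inordK //.
    by case: eqP => // ji; move: (ltn_ord j); rewrite ji ltnS leqNgt li.
  rewrite inordK // -(eqn_add2l (l * n.-1)) subnKC //.
  exact: ltnW.
Qed.

Lemma update_id (T : eqType) (x : T -> G) (i : T) : [eta x with i |-> x i] = x :> (T -> G).
Proof. by apply/funext => j /=; case: eqP => // ->. Qed.

(** * Obstructions to being absorbing *)

Variables (t : nat) (delta : hyperideal G -> hyperideal G) (Q : hyperideal G).
Hypothesis Qdelta : ideal_set Q `<=` ideal_set (delta Q).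

(** A tuple violating the condition for [Q] to be absorbing. *)
Definition obstruction (a : 'I_(t * n.-1).+1 -> G) : Prop :=
  ideal_set Q (kprod a) /\ ~ has_subproduct_in (delta Q) a.

Lemma obstruction_perturb (a : 'I_(t * n.-1).+1 -> G) (i : 'I_(t * n.-1).+1)
    (q b : G) :
  obstruction a -> ideal_set Q q -> hadd2 q (a i) b ->
  obstruction [eta a with i |-> b].
Proof.
move=> [Qa aN] Qq qab; split.
  have tF := kprod_translation a i.
  have Qai : ideal_set Q (kprod [eta a with i |-> a i]) by rewrite update_id.
  apply: (hyperideal_hadd2 (translation_absorb tF Qq) Qai).
  by rewrite -(translation_hadd2 _ _ tF); exists b.
move=> [f [f_inj Df]]; apply: aN; exists f; split => //.
have [[j fj]|iNf] := pselect (exists j, f j = i); last first.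
  move: Df; congr (ideal_set _ (kprod _)); apply/funext => j /=.
  by case: eqP => // fj; case: iNf; exists j.
have fE y : [eta a with i |-> y] \o f = [eta a \o f with j |-> y].
  by apply/funext => p /=; rewrite -fj (inj_eq f_inj).
rewrite fE in Df; have tF := kprod_translation (a \o f) j.
have DNq := Qdelta (translation_absorb tF (hyperideal_hopp Qq)).
apply: (hyperideal_hadd2 DNq Df).
rewrite -(translation_hadd2 _ _ tF); exists (a i).
  exact: hadd2_reversible.
by rewrite -fE update_id.
Qed.

Hypothesis obstruction_eq0 : forall a, obstruction a -> kprod a = hzero G.

Lemma kprod_mix_eq0 (q : 'I_(t * n.-1).+1 -> G) (r : nat)
    (a : 'I_(t * n.-1).+1 -> G) :
  (forall i, ideal_set Q (q i)) -> obstruction a -> r <= (t * n.-1).+1 ->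
  kprod (fun i : 'I_(t * n.-1).+1 => if i < r then q i else a i) = hzero G.
Proof.
move=> Qq; elim: r a => [|r IH] a oa ltr; first exact: obstruction_eq0.
pose i := Ordinal ltr.
pose x (a' : 'I_(t * n.-1).+1 -> G) (j : 'I_(t * n.-1).+1) :=
  if j < r then q j else a' j.
have tF := kprod_translation (x a) i.
have Fai : kprod [eta x a with i |-> a i] = hzero G.
  rewrite -[RHS](IH a oa (ltnW ltr)); congr kprod; apply/funext => j /=.
  by case: eqP => // ->; rewrite /= ltnn.
have Fb b : hadd2 (q i) (a i) b -> kprod [eta x a with i |-> b] = hzero G.
  move=> /(obstruction_perturb oa (Qq i)) ob.
  rewrite -[RHS](IH _ ob (ltnW ltr)); congr kprod; apply/funext => j /=.
  by rewrite /x; case: eqP => // ->; rewrite /= ltnn.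
have -> : (fun j : 'I_(t * n.-1).+1 => if j < r.+1 then q j else a j)
    = [eta x a with i |-> q i] :> (_ -> _).
  apply/funext => j; rewrite /= ltnS leq_eqVlt -(inj_eq val_inj) /=.
  by case: eqP => //= ji; congr q; apply/val_inj.
have := translation_hadd2 (q i) (a i) tF.
rewrite Fai hadd2_zeror => /seteqP[_ /(_ _ erefl)] [b qab <-].
exact: Fb.
Qed.

End Obstructions.

Theorem theorem2p30 (m n : nat) (hm : 2 <= m) (hn : 2 <= n)
    (G : krasner_hyperring m n) (one : G)
    (Gcomm : commutative_hyperring G) (Gone : scalar_identity one)
    (delta : hyperideal G -> hyperideal G)
    (delta_exp : hyperideal_expansion delta)
    (t : nat) (ht : 0 < t) (Q : hyperideal G)
    (Qweak : weakly_absorbing_semiprimary t delta Q)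
    (Qnot : ~ absorbing_semiprimary t delta Q) :
  forall q : 'I_(t * n.-1).+1 -> G,
    (forall i, ideal_set Q (q i)) -> kprod q = hzero G.
Proof.
move=> q Qq; have [Qproper Qabs] := Qweak; have [deltaS _] := delta_exp.
have [a oa] : exists a, @obstruction _ _ G t delta Q a.
  apply: contrapT => noa; apply: Qnot; split=> // a Qa.
  by apply: contrapT => aN; apply: noa; exists a.
have o0 a' : @obstruction _ _ G t delta Q a' -> kprod a' = hzero G.
  by move=> [Qa' a'N]; apply: contrapT => a'0; apply/a'N/Qabs.
have := kprod_mix_eq0 hm hn (deltaS Q) o0 Qq oa (leqnn _).
by under eq_fun do rewrite ltn_ord.
Qed.
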